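(* The set of real sequences with nonnegative Boolean transform is closed under Hadamard products: if $(a_n)_{n\ge1}$ and $(b_n)_{n\ge1}$ are real sequences all of whose Boolean transform terms are nonnegative, then all the terms of the Boolean transform of $(a_nb_n)_{n\ge1}$ are nonnegative.
   Context: The Boolean transform of a sequence $(a_n)_{n\ge1}$ is the sequence $(b_n)_{n\ge1}$ defined by the identity of formal power series $\sum_{n\ge1}b_nx^n=1-\dfrac{1}{1+\sum_{n\ge1}a_nx^n}$. A real sequence has nonnegative Boolean transform if all the terms of its Boolean transform are nonnegative. The Hadamard product of $(a_n)$ and $(b_n)$ is the termwise product $(a_nb_n)$. *)

(* Defs.v *)
From HB Require Import structures.
From mathcomp Require Import all_boot all_order all_algebra.
From mathcomp Require Import reals.

Set Implicit Arguments.
Unset Strict Implicit.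
Unset Printing Implicit Defensive.

Import Order.TTheory GRing.Theory Num.Theory.
Local Open Scope ring_scope.

(* The series f_0 + f_1 x + f_2 x^2 + ... is its coefficient function.
   The operations get their own names because the library's pointwise product
   on functions is not the product of series. *)
Definition fps (R : realType) := nat -> R.

Definition fps_one (R : realType) : fps R := fun n => (n == 0%N)%:R.

Definition fps_add (R : realType) (f g : fps R) : fps R := fun n => f n + g n.

Definition fps_sub (R : realType) (f g : fps R) : fps R := fun n => f n - g n.

Definition fps_mul (R : realType) (f g : fps R) : fps R :=
  fun n => \sum_(i < n.+1) f i * g (n - i)%N.

(* [fps_inv_coefs f n] lists the first n coefficients g_0, ..., g_(n-1) of 1/f:
   g_0 = 1/f_0 and g_m = - (f_1 g_(m-1) + ... + f_m g_0) / f_0. *)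
Fixpoint fps_inv_coefs (R : realType) (f : fps R) (n : nat) : seq R :=
  if n is m.+1 then
    let s := fps_inv_coefs f m in
    rcons s (((m == 0%N)%:R - \sum_(i < m) f i.+1 * s`_(m - i.+1)) / f 0%N)
  else [::].

(* The inverse of f in the ring of formal power series, meaningful when
   f_0 != 0; see [fps_mulfV] and [fps_inv_uniq]. *)
Definition fps_inv (R : realType) (f : fps R) : fps R :=
  fun n => (fps_inv_coefs f n.+1)`_n.

(* A sequence (a_n)_(n >= 1) is a function on nat whose value at 0 is junk;
   [gen_series a] is the sum of a_n x^n over n >= 1. *)
Definition gen_series (R : realType) (a : nat -> R) : fps R :=
  fun n => if n == 0%N then 0 else a n.

Definition boolean_transform (R : realType) (a : nat -> R) : nat -> R :=
  fps_sub (@fps_one R) (fps_inv (fps_add (@fps_one R) (gen_series a))).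

Definition nonneg_boolean_transform (R : realType) (a : nat -> R) : Prop :=
  forall n : nat, (1 <= n)%N -> 0 <= boolean_transform a n.

Definition hadamard (R : realType) (a b : nat -> R) : nat -> R :=
  fun n => a n * b n.

Lemma size_fps_inv_coefs (R : realType) (f : fps R) (n : nat) :
  size (fps_inv_coefs f n) = n.
Proof. by elim: n => //= n IHn; rewrite size_rcons IHn. Qed.

Lemma nth_fps_inv_coefs (R : realType) (f : fps R) (m n : nat) :
  (m < n)%N -> (fps_inv_coefs f n)`_m = fps_inv f m.
Proof.
elim: n => // n IHn; rewrite ltnS leq_eqVlt => /predU1P[-> //|lt_mn].
by rewrite /= nth_rcons size_fps_inv_coefs lt_mn IHn.
Qed.

Lemma fps_invE (R : realType) (f : fps R) (n : nat) :
  fps_inv f n =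
  ((n == 0%N)%:R - \sum_(i < n) f i.+1 * fps_inv f (n - i.+1)%N) / f 0%N.
Proof.
rewrite {1}/fps_inv /= nth_rcons size_fps_inv_coefs ltnn eqxx.
congr ((_ - _) / _); apply: eq_bigr => i _.
by rewrite nth_fps_inv_coefs // ltn_subrL (leq_ltn_trans _ (ltn_ord i)).
Qed.

Lemma fps_mulfV (R : realType) (f : fps R) :
  f 0%N != 0 -> fps_mul f (fps_inv f) =1 @fps_one R.
Proof.
move=> f0 n; rewrite /fps_mul big_ord_recl subn0 {1}fps_invE.
by rewrite [f ord0 * _]mulrC divfK // subrK.
Qed.

Lemma fps_inv_uniq (R : realType) (f g : fps R) :
  f 0%N != 0 -> fps_mul f g =1 @fps_one R -> g =1 fps_inv f.
Proof.
move=> f0 fg1 n; elim/ltn_ind: n => n IHn; rewrite fps_invE.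
have := fg1 n; rewrite /fps_mul /fps_one big_ord_recl subn0 => <-.
rewrite -addrA -sumrB big1 ?addr0 => [|i _]; first by rewrite mulrC mulKf.
by rewrite IHn ?subrr // ltn_subrL (leq_ltn_trans _ (ltn_ord i)).
Qed.

Lemma boolean_transform0 (R : realType) (a : nat -> R) :
  boolean_transform a 0%N = 0.
Proof.
rewrite /boolean_transform /fps_sub fps_invE big_ord0 subr0.
by rewrite /fps_add /gen_series /fps_one /= addr0 divr1 subrr.
Qed.

(* Main.v *)
Require Import Defs.
From mathcomp Require Import all_boot all_order all_algebra.
From mathcomp Require Import reals.

(** If [a] has Boolean transform [p], then [u = 1, a_1, a_2, ...] is a renewal
    sequence, with [p] not normalized to total mass 1: it solves
    [u_n = \sum_(i < n) p_(n - i) u_i] for [n > 0], so [u_n] is the total weight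
    of the compositions of [n], where a part of size [m] has weight [p_m].  A
    product [u_n v_n] then weighs pairs of compositions of [n].  Cutting such a
    pair at the partial sums that both compositions share splits it into pairs
    with no shared partial sum in their interior, which shows that
    [u_n v_n] is again renewal: its Boolean transform at [n] is the weight of
    the pairs of compositions of [n] with no shared interior partial sum, a
    sum of products of nonnegative numbers.

    The proof makes this algebraic.  Let [r] be the inverse of the series of
    [u_n v_n], so that the sought transform is [- r_n] for [n > 0], and put
    [G i j = \sum_k r_k u_(i - k) v_(j - k)].  By inclusion and exclusion this
    is the weight of the pairs of a composition of [i] and one of [j] sharing
    no positive partial sum.  On the diagonal [G] is the product of [r] with the
    series of [u_n v_n], hence vanishes except at the origin
    ([avoiding_weight_diag]).  Off the diagonal, removing the last part of the
    composition of the larger number cannot touch a shared partial sum, which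
    yields a recursion with nonnegative coefficients
    ([avoiding_weight_step]), so [G] is nonnegative ([avoiding_weight_ge0]).
    Removing both last parts at [(n, n)] expresses [- r_n] as a nonnegative
    combination of values of [G] ([inverse_renewal_product]). *)

Set Implicit Arguments.
Unset Strict Implicit.
Unset Printing Implicit Defensive.

Import Order.TTheory GRing.Theory Num.Theory.
Local Open Scope ring_scope.

Definition renewal (R : nzRingType) (p u : nat -> R) : Prop :=
  forall n, u n = (n == 0%N)%:R + \sum_(i < n) p (n - i)%N * u i.

(** Extending [u] by zero to negative indices makes the ranges of the sums in
    [avoiding_weight] independent of the point of evaluation, so that they can
    be exchanged freely. *)
Definition toeplitz (R : nzRingType) (u : nat -> R) (i k : nat) : R :=
  if (k <= i)%N then u (i - k)%N else 0.

(** The truncation [N] only has to exceed [i] or [j], as later terms vanish. *)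
Definition avoiding_weight (R : nzRingType) (r u v : nat -> R) (N i j : nat) :
  R := \sum_(k < N) r k * (toeplitz u i k * toeplitz v j k).

Lemma toeplitz_renewal (R : nzRingType) (p u : nat -> R) (i k : nat) :
  renewal p u ->
  toeplitz u i k =
  (k == i)%:R + \sum_(j < i) p (i - j)%N * toeplitz u j k.
Proof.
move=> pu; have [le_ki|lt_ik] := leqP k i; last first.
  rewrite /toeplitz leqNgt lt_ik (gtn_eqF lt_ik) add0r big1 // => j _.
  by rewrite leqNgt (ltn_trans (ltn_ord j) lt_ik) mulr0.
rewrite -(subnKC le_ki); move: (i - k)%N => d.
rewrite {1}/toeplitz leq_addr addKn pu big_split_ord /=.
rewrite [X in _ = _ + (X + _)]big1 ?add0r => [|j _]; last first.
  by rewrite /toeplitz leqNgt ltn_ord mulr0.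
congr ((nat_of_bool _)%:R + _).
  by rewrite -(eqn_add2l k) addn0 eq_sym.
by apply: eq_bigr => j _; rewrite subnDl /toeplitz leq_addr addKn.
Qed.

Lemma avoiding_weightC (R : comNzRingType) (r u v : nat -> R) (N i j : nat) :
  avoiding_weight r u v N i j = avoiding_weight r v u N j i.
Proof. by apply: eq_bigr => k _; rewrite [toeplitz u i k * _]mulrC. Qed.

(** The right-hand side is a coefficient of a product of series, so the diagonal
    becomes explicit once [r] is the inverse of the series of [u_n v_n]. *)
Lemma avoiding_weight_diag (R : nzRingType) (r u v : nat -> R) (N n : nat) :
  (n < N)%N ->
  avoiding_weight r u v N n n =
  \sum_(k < n.+1) r k * (u (n - k)%N * v (n - k)%N).
Proof.
move=> lt_nN; rewrite /avoiding_weight -(subnKC lt_nN) big_split_ord /=.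
rewrite [X in _ + X]big1 ?addr0 => [|k _]; last first.
  by rewrite /toeplitz leqNgt leq_addr mulr0 mulr0.
by apply: eq_bigr => k _; rewrite /toeplitz -ltnS ltn_ord.
Qed.

(** When [j < i], the partial sum [i] cannot be shared, so the last part of the
    composition of [i] can be removed. *)
Lemma avoiding_weight_step (R : comNzRingType) (p r u v : nat -> R)
    (N i j : nat) :
  renewal p u -> (j < i)%N ->
  avoiding_weight r u v N i j =
  \sum_(i' < i) p (i - i')%N * avoiding_weight r u v N i' j.
Proof.
move=> pu lt_ji.
under eq_bigr do rewrite /avoiding_weight mulr_sumr.
rewrite exchange_big; apply: eq_bigr => k _ /=.
rewrite (toeplitz_renewal i k pu) mulrDl mulrDr.
(* The index k = i contributes nothing, since it exceeds j. *)
have -> : (k == i :> nat)%:R * toeplitz v j k = 0.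
  by case: eqP => [->|_]; rewrite ?mul0r // /toeplitz leqNgt lt_ji mulr0.
rewrite mulr0 add0r mulr_suml mulr_sumr; apply: eq_bigr => i' _.
by rewrite -mulrA mulrCA.
Qed.

Lemma avoiding_weight_ge0 (R : numDomainType) (p q r u v : nat -> R)
    (N i j : nat) :
    renewal p u -> renewal q v ->
    (forall n, (0 < n)%N -> 0 <= p n) -> (forall n, (0 < n)%N -> 0 <= q n) ->
    (forall n, (n < N)%N -> 0 <= avoiding_weight r u v N n n) ->
  (i < N)%N -> (j < N)%N -> 0 <= avoiding_weight r u v N i j.
Proof.
move=> pu qv p_ge0 q_ge0 diag_ge0.
have [s] := ubnP (i + j)%N; elim: s => // s IHs in i j *.
rewrite ltnS => le_ijs lt_iN lt_jN; have [lt_ij|lt_ji|<-] := ltngtP i j.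
- rewrite avoiding_weightC (avoiding_weight_step _ _ _ qv lt_ij).
  apply: sumr_ge0 => j' _; apply: mulr_ge0; first by rewrite q_ge0 ?subn_gt0.
  rewrite avoiding_weightC IHs // ?(ltn_trans (ltn_ord j')) //.
  by apply: leq_trans le_ijs; rewrite ltn_add2l.
- rewrite (avoiding_weight_step _ _ _ pu lt_ji).
  apply: sumr_ge0 => i' _; apply: mulr_ge0; first by rewrite p_ge0 ?subn_gt0.
  rewrite IHs // ?(ltn_trans (ltn_ord i')) //.
  by apply: leq_trans le_ijs; rewrite ltn_add2r.
- exact: diag_ge0.
Qed.

(** The last parts of both compositions of [n] are removed at once.  The index
    [k = n] accounts for two empty compositions and gives [r n]; the mixed terms
    of the expanded product vanish, since an empty composition has no last part
    to remove. *)
Lemma inverse_renewal_product (R : comNzRingType) (p q r u v : nat -> R)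
    (N n : nat) :
  renewal p u -> renewal q v -> (n < N)%N ->
  avoiding_weight r u v N n n =
  r n + \sum_(i < n) \sum_(j < n)
          p (n - i)%N * q (n - j)%N * avoiding_weight r u v N i j.
Proof.
move=> pu qv lt_nN.
pose S (f w : nat -> R) k := \sum_(i < n) f (n - i)%N * toeplitz w i k.
have S0 f w : S f w n = 0.
  by rewrite /S big1 // => i _; rewrite /toeplitz leqNgt ltn_ord mulr0.
have expand k : toeplitz u n k * toeplitz v n k =
    (k == n)%:R + S p u k * S q v k.
  rewrite (toeplitz_renewal n k pu) (toeplitz_renewal n k qv) -/(S p u k).
  rewrite -/(S q v k); case: eqP => [->|_]; last by rewrite !add0r.
  by rewrite !S0 !addr0 mulr0 mulr1 addr0.
rewrite /avoiding_weight; under eq_bigr do rewrite expand mulrDr.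
rewrite big_split /=; congr (_ + _).
  rewrite (bigD1 (Ordinal lt_nN)) //= eqxx mulr1 big1 ?addr0 // => k.
  by rewrite -val_eqE /= => /negPf->; rewrite mulr0.
transitivity (\sum_(k < N) \sum_(i < n) \sum_(j < n)
    p (n - i)%N * q (n - j)%N * (r k * (toeplitz u i k * toeplitz v j k))).
  apply: eq_bigr => k _; rewrite /S mulr_suml mulr_sumr; apply: eq_bigr => i _.
  rewrite !mulr_sumr; apply: eq_bigr => j _.
  by rewrite mulrACA; apply: mulrCA.
rewrite exchange_big; apply: eq_bigr => i _; rewrite exchange_big.
by apply: eq_bigr => j _; rewrite mulr_sumr.
Qed.

Lemma boolean_transform_inv (R : realType) (a : nat -> R) (n : nat) :
  (0 < n)%N ->
  boolean_transform a n = - fps_inv (fps_add (@fps_one R) (gen_series a)) n.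
Proof.
by move=> n_gt0; rewrite /boolean_transform /fps_sub /fps_one gtn_eqF ?sub0r.
Qed.

Lemma fps_one_add_gen0 (R : realType) (a : nat -> R) :
  fps_add (@fps_one R) (gen_series a) 0%N = 1.
Proof. exact: addr0. Qed.

Lemma renewal_boolean_transform (R : realType) (a : nat -> R) :
  renewal (boolean_transform a) (fps_add (@fps_one R) (gen_series a)).
Proof.
move=> n; set u := fps_add _ _.
have u0 : u 0%N = 1 := fps_one_add_gen0 a.
have := @fps_mulfV R u; rewrite u0 oner_eq0 => /(_ isT n).
rewrite /fps_mul big_ord_recr /= subnn [fps_inv u 0%N]fps_invE big_ord0 subr0.
rewrite u0 divr1 mulr1 /fps_one => <-.
rewrite addrAC -big_split /= big1 ?add0r // => i _.
rewrite boolean_transform_inv ?subn_gt0 //.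
by rewrite mulNr mulrC subrr.
Qed.

Lemma fps_one_add_gen_hadamard (R : realType) (a b : nat -> R) (n : nat) :
  fps_add (@fps_one R) (gen_series (hadamard a b)) n =
  fps_add (@fps_one R) (gen_series a) n * fps_add (@fps_one R) (gen_series b) n.
Proof.
by case: n => [|n]; rewrite ?fps_one_add_gen0 ?mulr1 // /fps_add !add0r.
Qed.

Theorem corollaryA4 (R : realType) (a b : nat -> R)
  (ha : nonneg_boolean_transform a) (hb : nonneg_boolean_transform b) :
  nonneg_boolean_transform (hadamard a b).
Proof.
move=> n n_gt0; rewrite boolean_transform_inv //.
set w := fps_add _ _; set r := fps_inv w.
have pu := renewal_boolean_transform a; have qv := renewal_boolean_transform b.
set u := fps_add _ _ in pu; set v := fps_add _ _ in qv.
have wE m : w m = u m * v m := fps_one_add_gen_hadamard a b m.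
have diag m : (m < n.+1)%N -> avoiding_weight r u v n.+1 m m = (m == 0%N)%:R.
  move=> lt_mn; rewrite avoiding_weight_diag //.
  have := @fps_mulfV R w; rewrite (fps_one_add_gen0 _ : w 0%N = 1) oner_eq0.
  rewrite -/(fps_one R m) => /(_ isT m) <-.
  rewrite /fps_mul (reindex_inj rev_ord_inj); apply: eq_bigr => k _ /=.
  have le_km : (k <= m)%N by rewrite -ltnS.
  by rewrite subSS subKn // -wE mulrC.
have /eqP := inverse_renewal_product r pu qv (ltnSn n).
rewrite diag // gtn_eqF // eq_sym addrC addr_eq0 => /eqP <-.
apply: sumr_ge0 => i _; apply: sumr_ge0 => j _; apply: mulr_ge0.
  by apply: mulr_ge0; [apply: ha | apply: hb]; rewrite subn_gt0.
apply: avoiding_weight_ge0 pu qv ha hb _ _ _; last 2 first.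
- by rewrite ltnS ltnW.
- by rewrite ltnS ltnW.
by move=> m lt_mn; rewrite diag // ler0n.
Qed.
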